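(* Let $D=(D_1,\dots,D_L)$ be a sequence of real numbers and let $1\le i\le j\le L$. If $a\in B(i)$ and $a\ge j$, then $a\in B(j)$.
   Context: For a sequence $F$ of reals and $1\le s\le t\le |F|$ write $\bar F(s,t)$ for the average of $F_s,\dots,F_t$. An index $1\le k\le |F|$ is a border of $F$ if there is a (possibly empty) sequence $E$ such that, with $G$ the concatenation of $F$ and $E$, $\bar G(k,|G|)=\max_{1\le s\le |G|}\bar G(s,|G|)$. For $1\le i\le L$, $B(i)$ denotes the set of indices $b$ with $i\le b\le L$ such that $b-i+1$ is a border of the sequence $(D_i,\dots,D_L)$. *)

(* Defs.v *)
From mathcomp Require Import all_boot all_order all_algebra.
From mathcomp Require Import classical_sets reals.
Set Implicit Arguments.
Unset Strict Implicit.
Unset Printing Implicit Defensive.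
Import Order.TTheory GRing.Theory Num.Theory.
Local Open Scope ring_scope.
Local Open Scope classical_set_scope.

(* A finite sequence F_1, ..., F_n is a [seq R]; positions are 1-based, so the
   term F_k is the library's 0-based [F`_k.-1]. *)
Definition term (R : realType) (F : seq R) (k : nat) : R := F`_k.-1.

(* Meaningful for 1 <= s <= t <= size F. *)
Definition average (R : realType) (F : seq R) (s t : nat) : R :=
  (\sum_(s <= k < t.+1) term F k) / (t.+1 - s)%:R.

Definition is_max (R : realType) (A : set R) (m : R) : Prop :=
  A m /\ forall x, A x -> x <= m.

Definition border (R : realType) (F : seq R) (k : nat) : Prop :=
  (1 <= k <= size F)%N /\
  exists E : seq R, let G := F ++ E in
    is_max [set average G s (size G) | s in [set s | (1 <= s <= size G)%N]]
      (average G k (size G)).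

(* For i >= 1, [drop i.-1 D] is (D_i, ..., D_L), where L = size D. *)
Definition B (R : realType) (D : seq R) (i : nat) : set nat :=
  [set b | (i <= b <= size D)%N /\ border (drop i.-1 D) (b - i + 1)%N].

(* Main.v *)
Require Import Defs.
From mathcomp Require Import all_boot all_order all_algebra.
From mathcomp Require Import classical_sets reals.
From mathcomp Require Import zify.

(* Averages over suffixes of a sequence do not see the dropped prefix, so an
   extension [E] witnessing that [k] is a border of [F] also witnesses that
   [k - n] is a border of [drop n F]. *)

(** Keep the same extension [E] for both sequences. The averages competing at [j] are then those
    competing at [i] whose start is at least [j], renumbered by [j - i]. A maximum over the larger
    family that is attained at [a >= j] stays the maximum over the subfamily. This is [border_drop]
    with [n = j - i]. *)

Lemma average_drop (R : realType) (G : seq R) (n s : nat) :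
  (1 <= s)%N -> (n <= size G)%N ->
  average (drop n G) s (size (drop n G)) = average G (n + s) (size G).
Proof.
move=> s_gt0 nG; rewrite /average size_drop.
have -> : ((size G).+1 - (n + s) = (size G - n).+1 - s)%N by lia.
congr (_ / _)%R; have -> : (size G).+1 = ((size G - n).+1 + n)%N by lia.
(* The range condition is kept because [n + k.-1 = (k + n).-1] can fail at [k = 0]. *)
rewrite addnC big_addn addnK [LHS]big_nat_cond [RHS]big_nat_cond.
apply: eq_bigr => k /andP[/andP[sk _] _].
by rewrite /term nth_drop; congr nth; lia.
Qed.

Lemma border_drop (R : realType) (F : seq R) (n k : nat) :
  (n < k)%N -> border F k -> border (drop n F) (k - n).
Proof.
move=> nk [/andP[_ kF] [E [_ kmax]]].
split; first by rewrite size_drop; lia.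
exists E => /=; have nF : (n <= size F)%N by lia.
have nG : (n <= size (F ++ E))%N by rewrite size_cat; lia.
have -> : drop n F ++ E = drop n (F ++ E).
  rewrite drop_cat; case: ltnP => // Fn.
  (* With [nF], this case means [n = size F], and both sides are [E]. *)
  have nE : (n - size F = 0)%N by lia.
  by rewrite drop_oversize // nE drop0.
split.
  by exists (k - n)%N => //=; rewrite size_drop size_cat; lia.
move=> _ [s /= /andP[s_gt0 sG] <-].
rewrite !average_drop ?subn_gt0 // subnKC 1?ltnW //.
by apply: kmax; exists (n + s)%N => //=; move: sG; rewrite size_drop; lia.
Qed.

Theorem theorem7 (R : realType) (D : seq R) (i j a : nat)
  (hi : (1 <= i)%N) (hij : (i <= j)%N) (hj : (j <= size D)%N)
  (ha : B D i a) (haj : (j <= a)%N) :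
  B D j a.
Proof.
case: ha => /andP[ia aD] /(@border_drop _ _ (j - i)); rewrite drop_drop.
have -> : (j - i + i.-1 = j.-1)%N by lia.
have -> : (a - i + 1 - (j - i) = a - j + 1)%N by lia.
by move=> bj; split; [rewrite haj | apply: bj; lia].
Qed.
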